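(* Let $q\ge 1$ and $n$ be integers with $q\le n$. Every one-time oracle signature scheme $(\mathsf{Gen},\mathsf{Sign},\mathsf{Ver})$ for messages in $\{0,1\}^n$, relative to a random oracle, in which at most $q$ oracle queries are made in total by $\mathsf{Gen}$, $\mathsf{Sign}$ and $\mathsf{Ver}$, has black-box security at most $2^{(1+o(1))q}$, where the $o(1)$ term tends to $0$ as $q\to\infty$.
   Context: Random oracle: for each input length $\ell$, an independent uniformly random function $\{0,1\}^\ell\to\{0,1\}^\ell$, accessible only by queries. An oracle signature scheme for a message space $\mathcal{M}$ is a triple of oracle algorithms $(\mathsf{Gen},\mathsf{Sign},\mathsf{Ver})$, where $\mathsf{Gen}$ may be probabilistic, $\mathsf{Gen}^{\mathcal{O}}$ outputs a pair $(SK,VK)$ (signing and verification key), and (perfect completeness) for every oracle $\mathcal{O}$, every $(SK,VK)$ output by $\mathsf{Gen}^{\mathcal{O}}$ with positive probability, and every $\alpha\in\mathcal{M}$, $\mathsf{Ver}^{\mathcal{O}}(VK,\alpha,\mathsf{Sign}^{\mathcal{O}}(SK,\alpha))=1$. The total number of queries of the scheme is the total number of oracle queries made when generating keys, signing one message and verifying that signature. Black-box security $S$: for every message $\alpha\in\mathcal{M}$, every $1\le T\le S$, and every (computationally unbounded) adversary $A$ making at most $T$ oracle queries, the probability that $A^{\mathcal{O}}(VK,\mathsf{Sign}^{\mathcal{O}}(SK,\alpha))$ outputs a pair $(\alpha^*,\sigma^* )$ with $\alpha^*\neq\alpha$ and $\mathsf{Ver}^{\mathcal{O}}(VK,\alpha^*,\sigma^*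 )=1$ is at most $T/S$, where $(SK,VK)=\mathsf{Gen}^{\mathcal{O}}$ and the probability is over the oracle and the coins of all algorithms. ''Black-box security at most $S_0$'' means the scheme does not have black-box security $S$ for any $S> S_0$. *)

(* Defs.v *)
From HB Require Import structures.
From mathcomp Require Import all_boot all_order all_algebra.
From mathcomp Require Import all_classical all_reals all_analysis.

Set Implicit Arguments.
Unset Strict Implicit.
Unset Printing Implicit Defensive.

Import Order.TTheory GRing.Theory Num.Theory.
Import numFieldNormedType.Exports.

Local Open Scope classical_set_scope.
Local Open Scope ring_scope.

Definition bits := seq bool.

Definition length_preserving (l : nat) :=
  {ffun l.-tuple bool -> l.-tuple bool}.

Definition oracle := forall l : nat, length_preserving l.

(* On a probability space (T, P), [O w l] is the function answering the
   queries of length l at the outcome w: for each l it is uniformly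
   distributed, and these functions are mutually independent over l. *)
Record is_random_oracle (R : realType) (d : measure_display)
    (T : measurableType d) (P : probability T R) (O : T -> oracle) : Prop := {
  ro_measurable : forall l (f : length_preserving l),
    measurable [set w | O w l = f] ;
  ro_uniform : forall l (f : length_preserving l),
    P [set w | O w l = f] = (#|{: length_preserving l}|%:R^-1)%:E ;
  ro_independent : forall (s : seq nat)
      (E : forall l : nat, {set length_preserving l}),
    uniq s ->
    fine (P [set w | forall l, l \in s -> O w l \in E l]) =
    \prod_(l <- s) fine (P [set w | O w l \in E l])
}.

(* Deterministic oracle algorithms with output in A, as decision trees: the
   oracle is reached only through queries and every execution halts. No
   computability or running time restriction is imposed. *)
Inductive oalg (A : Type) : Type :=
| Ret of A
| Query (l : nat) of l.-tuple bool & (l.-tuple bool -> oalg A).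

Fixpoint run (O : oracle) (A : Type) (t : oalg A) : A :=
  match t with
  | Ret a => a
  | Query l x k => run O (k (O l x))
  end.

Fixpoint nqueries (O : oracle) (A : Type) (t : oalg A) : nat :=
  match t with
  | Ret _ => 0
  | Query l x k => (nqueries O (k (O l x))).+1
  end.

(* Probabilistic oracle algorithms: the coins are drawn beforehand, according
   to an arbitrary discrete distribution. This loses no generality over
   (possibly unboundedly many) coin flips during the execution, since for a
   countable type A there are only countably many trees in oalg A. *)
Record prob_oalg (R : realType) (A : Type) : Type := ProbOalg {
  coins : probability nat R ;
  exec : nat -> oalg A
}.

Record signature_scheme (R : realType) (n : nat) : Type := SignatureScheme {
  gen : prob_oalg R (bits * bits) ; (* (SK, VK) *)
  sign : bits -> n.-tuple bool -> oalg bits ;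
  ver : bits -> n.-tuple bool -> bits -> oalg bool ;
  perfect_completeness : forall (O : oracle) (sk vk : bits) (a : n.-tuple bool),
    (0 < coins gen [set c | run O (exec gen c) = (sk, vk)])%E ->
    run O (ver vk a (run O (sign sk a))) = true
}.

(* Repeated queries are counted each time they are made. *)
Definition total_queries (R : realType) (n : nat) (Sch : signature_scheme R n)
    (O : oracle) (c : nat) (a : n.-tuple bool) : nat :=
  let: (sk, vk) := run O (exec (gen Sch) c) in
  let sigma := run O (sign Sch sk a) in
  (nqueries O (exec (gen Sch) c) + nqueries O (sign Sch sk a)
   + nqueries O (ver Sch vk a sigma))%N.

Definition makes_at_most (R : realType) (n : nat) (Sch : signature_scheme R n)
    (q : nat) : Prop :=
  forall (O : oracle) (c : nat) (a : n.-tuple bool),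
    (0 < coins (gen Sch) [set c])%E -> (total_queries Sch O c a <= q)%N.

(* Input: a verification key and a signature; output: a forgery. *)
Definition adversary (R : realType) (n : nat) : Type :=
  bits -> bits -> prob_oalg R (n.-tuple bool * bits).

Definition adversary_at_most (R : realType) (n : nat) (A : adversary R n)
    (t : nat) : Prop :=
  forall (O : oracle) (vk sigma : bits) (r : nat),
    (nqueries O (exec (A vk sigma) r) <= t)%N.

Definition valid_forgery (R : realType) (n : nat) (Sch : signature_scheme R n)
    (O : oracle) (vk : bits) (a : n.-tuple bool)
    (forgery : n.-tuple bool * bits) : bool :=
  (forgery.1 != a) && run O (ver Sch vk forgery.1 forgery.2).

(* For a fixed oracle and fixed coins c of Gen; over the coins of A. *)
Definition forging_prob_given (R : realType) (n : nat)
    (Sch : signature_scheme R n) (A : adversary R n) (a : n.-tuple bool)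
    (O : oracle) (c : nat) : \bar R :=
  let: (sk, vk) := run O (exec (gen Sch) c) in
  let B := A vk (run O (sign Sch sk a)) in
  coins B [set r | valid_forgery Sch O vk a (run O (exec B r))].

(* The oracle, the coins of Gen and those of A are drawn independently, except
   that the distribution of the latter may depend on the input of A. *)
Definition forging_prob (R : realType) (d : measure_display)
    (T : measurableType d) (P : probability T R) (O : T -> oracle) (n : nat)
    (Sch : signature_scheme R n) (A : adversary R n) (a : n.-tuple bool)
    : \bar R :=
  (\int[P]_w \int[coins (gen Sch)]_c forging_prob_given Sch A a (O w) c)%E.

Definition blackbox_security (R : realType) (d : measure_display)
    (T : measurableType d) (P : probability T R) (O : T -> oracle) (n : nat)
    (Sch : signature_scheme R n) (S : R) : Prop :=
  forall (a : n.-tuple bool) (t : nat) (A : adversary R n),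
    (1 <= t)%N -> t%:R <= S -> adversary_at_most A t ->
    (forging_prob P O Sch A a <= (t%:R / S)%:E)%E.

Definition blackbox_security_at_most (R : realType) (d : measure_display)
    (T : measurableType d) (P : probability T R) (O : T -> oracle) (n : nat)
    (Sch : signature_scheme R n) (S0 : R) : Prop :=
  forall S : R, S0 < S -> ~ blackbox_security P O Sch S.

(* Main.v *)
Require Import Defs.
From HB Require Import structures.
From mathcomp Require Import all_boot all_order all_algebra.
From mathcomp Require Import ring lra zify.

(** A security bound [T/S] for all [T] is already violated by an attack that
    makes polynomially many queries and succeeds with probability about
    [2^-q]. Fix two messages [a <> b]. The attacker, given [VK] and a signature
    of [a], keeps asking the queries that are likely, conditionally on what it
    knows, to have been made by [Gen], [Sign a] or [Ver a]; since these make at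
    most [q] queries, an exponentially small failure probability costs only
    [poly(q)] steps, and all the queries of [Ver a] are learned on the way. It
    then picks a world (coins of [Gen] and an oracle) that is consistent with
    its knowledge, and signs [b] in that world, answering the queries that
    [Gen] and [Sign a] make there as in that world, and all the others by the
    true oracle. The signature is valid for the true oracle as soon as [Ver b],
    in the picked world, meets [Gen] and [Sign a] only in known queries.
    Exchanging the answers of the true and of the picked world on the new
    queries of [Sign b] and [Ver b] shows that this happens with at least half
    the probability that, in the true world, [Ver b] meets [Gen] and [Sign a]
    only in queries of [Ver a]. By the set-pairs inequality of Bollobas,
    applied to the sets of queries of [Gen] and [Sign a] outside [Ver a], and of
    [Ver a], in every world that event occurs for at least [2^(q-1)] of the
    pairs formed from [2^q] messages. *)

Set Implicit Arguments.
Unset Strict Implicit.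
Unset Printing Implicit Defensive.

Import Order.TTheory GRing.Theory Num.Theory.
Local Open Scope ring_scope.

(** * Cross-intersecting set pairs *)

(** The exponent [q.-1], not [q], is what counts: [2 ^ q] messages then exceed every family without
    compatible pairs by at least [2 ^ q.-1]. *)
Lemma bin_le_half_pow q k : (0 < q)%N -> ('C(q, k) <= 2 ^ q.-1)%N.
Proof.
case: q => // q _ /=; case: k => [|k]; first by rewrite bin0 expn_gt0.
rewrite binS; elim: q k => [|q IH] k; first by case: k.
rewrite expnS mul2n -addnn; apply: leq_add; first by rewrite binS IH.
by case: k => [|k]; rewrite ?bin0 ?expn_gt0 // binS IH.
Qed.

Lemma bin_le_half_pow_le q a b :
  (0 < q)%N -> (a + b <= q)%N -> ('C(a + b, a) <= 2 ^ q.-1)%N.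
Proof.
move=> q0 abq; case: (posnP (a + b)) => [->|ab0].
  by case: a {abq} => [|a]; rewrite ?bin0 ?bin0n ?expn_gt0.
by apply: leq_trans (bin_le_half_pow _ ab0) _; rewrite leq_pexp2l //; lia.
Qed.

Section Bollobas.
Variables (T I : finType).

(** For disjoint [X] and [Y], the probability that a random ordering of the ground set puts all of
    [X] before all of [Y]. *)
Definition bollobas_weight (X Y : {set T}) : rat :=
  ('C(#|X| + #|Y|, #|X|)%:R)^-1.

Lemma bollobas_weight_le1 X Y : bollobas_weight X Y <= 1.
Proof. by rewrite invf_le1 ?ltr0n ?ler1n bin_gt0 leq_addr. Qed.

(** The absorption identity for binomials, read on reciprocals. It evaluates the deletions of points
    of [Y] in the averaging below. *)
Lemma bollobas_weightD1 (X Y : {set T}) y : y \in Y ->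
  #|Y|%:R * bollobas_weight X (Y :\ y) =
  (#|X| + #|Y|)%:R * bollobas_weight X Y.
Proof.
move=> yY; have cY : #|Y| = #|Y :\ y|.+1 by rewrite (cardsD1 y) yY.
rewrite /bollobas_weight cY; set a := #|X|; set b := #|Y :\ y|.
have E1 : 'C((a + b).+1, b.+1) = 'C(a + b.+1, a).
  by rewrite -[in LHS](addKn a b.+1) -addnS bin_sub // leq_addr.
have E2 : 'C(a + b, b) = 'C(a + b, a).
  by rewrite -(bin_sub (leq_addl a b)) addnK.
move: (mul_bin_diag (a + b).+1 b); rewrite /= E2 E1 -addnS.
move=> /(congr1 (fun n => n%:R : rat)).
rewrite !natrM => H.
have n1 : 'C(a + b, a)%:R != 0 :> rat by rewrite pnatr_eq0 -lt0n bin_gt0 leq_addr.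
have n2 : 'C(a + b.+1, a)%:R != 0 :> rat by rewrite pnatr_eq0 -lt0n bin_gt0 leq_addr.
by apply/eqP; rewrite eqr_div // -H mulrC.
Qed.

(* Bollobas' set-pairs inequality, by averaging over the deletion of a point
   [x] of the ground set: the pairs with [x \notin X i], with [x] removed from
   [Y i], still cross-intersect. *)
Lemma bollobas (U : {set T}) (J : {set I}) (X Y : I -> {set T}) :
  (forall i, i \in J -> (X i \subset U) && (Y i \subset U)) ->
  (forall i, i \in J -> [disjoint X i & Y i]) ->
  (forall i j, i \in J -> j \in J -> i != j -> ~~ [disjoint X i & Y j]) ->
  \sum_(i in J) bollobas_weight (X i) (Y i) <= 1.
Proof.
move En: #|U| => n; elim: n U J X Y En => [|n IH] U J X Y En sub dis cross.
  have U0 : U = set0 by apply/eqP; rewrite -cards_eq0 En.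
  have J1 : (#|J| <= 1)%N.
    apply/card_le1_eqP => i j iJ jJ; apply/eqP/negPn/negP => ij.
    have /andP[_] := sub _ jJ; rewrite U0 subset0 => /eqP Yj.
    by have := cross _ _ iJ jJ; rewrite eq_sym ij Yj -setI_eq0 setI0 eqxx => /(_ isT).
  apply: le_trans (ler_sum _ (fun i _ => bollobas_weight_le1 _ _)) _.
  by rewrite sumr_const -[leRHS]/(1%:R) ler_nat.
(* An empty [Y i0] meets no [X i], so [i0] is alone in [J]. Absorption, used below, needs a point in
   every [Y i]. *)
have [/existsP[i0 /andP[i0J /eqP Y0]]|] := boolP [exists i, (i \in J) && (Y i == set0)].
  have J1 : (#|J| <= 1)%N.
    rewrite (cardsD1 i0) i0J add1n ltnS leqn0 cards_eq0.
    apply/eqP/setP => i; rewrite !inE; apply/negP => /andP[ii iJ].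
    by have := cross _ _ iJ i0J ii; rewrite Y0 -setI_eq0 setI0 eqxx.
  apply: le_trans (ler_sum _ (fun i _ => bollobas_weight_le1 _ _)) _.
  by rewrite sumr_const -[leRHS]/(1%:R) ler_nat.
rewrite negb_exists => /forallP Yn0.
have Un0 : 0 < (#|U|%:R : rat) by rewrite ltr0n En.
rewrite -(ler_pM2l Un0) mulr1 mulr_sumr.
have step x : x \in U ->
    \sum_(i in J | x \notin X i) bollobas_weight (X i) (Y i :\ x) <= 1.
  move=> xU; pose K := [set i in J | x \notin X i].
  have -> : \sum_(i in J | x \notin X i) bollobas_weight (X i) (Y i :\ x) =
            \sum_(i in K) bollobas_weight (X i) (Y i :\ x).
    by apply: eq_bigl => i; rewrite inE.
  apply: (IH (U :\ x)) => [|i|i|i j].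
  - by move: En; rewrite (cardsD1 x) xU => -[].
  - rewrite inE => /andP[iJ xX]; have /andP[XU YU] := sub _ iJ.
    by rewrite subsetD1 XU xX setSD.
  - rewrite inE => /andP[iJ _]; apply: disjointWr (dis _ iJ); exact: subD1set.
  - rewrite !inE => /andP[iJ xi] /andP[jJ xj] ij.
    have /pred0Pn[y /andP[/= yX yY]] := cross _ _ iJ jJ ij.
    apply/pred0Pn; exists y; rewrite /= yX !inE yY andbT.
    by apply: contraNneq xi => <-.
have : \sum_(x in U) \sum_(i in J | x \notin X i) bollobas_weight (X i) (Y i :\ x)
        <= #|U|%:R.
  by rewrite -sumr_const; apply: ler_sum => x; exact: step.
apply: le_trans; rewrite (exchange_big_dep (mem J)) /=; last by move=> x i _ /andP[].
apply: ler_sum => i iJ.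
have /andP[XU YU] := sub _ iJ; have dXY := dis _ iJ.
(* The sum over [x] outside [X i] is [#|U|] times the weight of [i]: the points of [Y i] give the
   factor [#|X i| + #|Y i|] by absorption, and the points outside both sets, whose deletion changes
   nothing, give the rest. *)
rewrite (bigID (mem (Y i))) /=.
have -> : \sum_(x | (x \in U) && ((i \in J) && (x \notin X i)) && (x \in Y i))
            bollobas_weight (X i) (Y i :\ x) =
          (#|X i| + #|Y i|)%:R * bollobas_weight (X i) (Y i).
  rewrite (eq_bigl (mem (Y i))); last first.
    move=> x /=; rewrite iJ /=; case xY: (x \in Y i); rewrite ?andbF // andbT.
    by rewrite (subsetP YU) //= (disjointFl dXY).
  have [y yY] : exists y, y \in Y i.
    by apply/set0Pn; have := Yn0 i; rewrite iJ.
  rewrite -(bollobas_weightD1 _ yY) -sumr_const mulr_suml; apply: eq_bigr => x xY.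
  have {}xY : x \in Y i by [].
  have : #|Y i :\ y| = #|Y i :\ x|.
    by have := cardsD1 x (Y i); rewrite (cardsD1 y (Y i)) xY yY => -[].
  by rewrite mul1r /bollobas_weight => ->.
have -> : \sum_(x | (x \in U) && ((i \in J) && (x \notin X i)) && (x \notin Y i))
            bollobas_weight (X i) (Y i :\ x) =
          (#|U| - (#|X i| + #|Y i|))%:R * bollobas_weight (X i) (Y i).
  rewrite (eq_bigl (mem (U :\: (X i :|: Y i)))); last first.
    by move=> x /=; rewrite iJ !inE negb_or /=; do !case: (x \in _).
  have <- : #|U :\: (X i :|: Y i)| = (#|U| - (#|X i| + #|Y i|))%N.
    rewrite cardsD (setIidPr _) ?subUset ?XU // cardsU.
    by move: dXY; rewrite -setI_eq0 => /eqP ->; rewrite cards0 subn0.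
  rewrite -sumr_const mulr_suml; apply: eq_bigr => x.
  rewrite !inE negb_or => /andP[/andP[_ xY] _]; rewrite mul1r; congr bollobas_weight.
  by apply/setP => y; rewrite !inE; case: eqP => // ->; rewrite (negPf xY).
rewrite -mulrDl -natrD subnKC //.
have -> : (#|X i| + #|Y i| = #|X i :|: Y i|)%N.
  by rewrite cardsU; move: dXY; rewrite -setI_eq0 => /eqP ->; rewrite cards0 subn0.
by rewrite subset_leq_card // subUset XU.
Qed.

Corollary bollobas_card (q : nat) (J : {set I}) (X Y : I -> {set T}) :
  (0 < q)%N ->
  (forall i, i \in J -> [disjoint X i & Y i]) ->
  (forall i, i \in J -> (#|X i| + #|Y i| <= q)%N) ->
  (forall i j, i \in J -> j \in J -> i != j -> ~~ [disjoint X i & Y j]) ->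
  (#|J| <= 2 ^ q.-1)%N.
Proof.
move=> q0 dis leq cross.
have sub i : i \in J -> (X i \subset setT) && (Y i \subset setT).
  by rewrite !subsetT.
have H := bollobas sub dis cross.
rewrite -(ler_nat rat) -[leRHS]mul1r -ler_pdivrMr ?ltr0n ?expn_gt0 //.
apply: le_trans H; rewrite -sumr_const mulr_suml; apply: ler_sum => i iJ.
rewrite mul1r lef_pV2 ?posrE ?ltr0n ?expn_gt0 ?bin_gt0 ?leq_addr // ler_nat.
by apply: bin_le_half_pow_le => //; exact: leq.
Qed.

End Bollobas.

(** While [M] contains an edge, remove one of its ends: this costs one element and destroys at least
    one ordered edge. What remains is independent. *)
Lemma card_le_independent_edges (I : finType) (r : rel I) (N : nat) :
  (forall J : {set I},
     (forall i j, i \in J -> j \in J -> i != j -> ~~ r i j) -> (#|J| <= N)%N) ->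
  forall M : {set I},
    (#|M| <= N + #|[set z : I * I | [&& z.1 \in M, z.2 \in M, z.1 != z.2
                                      & r z.1 z.2]]|)%N.
Proof.
move=> indep M; move En: #|M| => n; elim: n M En => [//|n IH] M En.
have [/existsP[[i j] /and4P[/= iM jM ij rij]]|] :=
  boolP [exists z : I * I, [&& z.1 \in M, z.2 \in M, z.1 != z.2 & r z.1 z.2]].
  have EM : #|M :\ i| = n by move: En; rewrite (cardsD1 i) iM => -[].
  apply: leq_ltn_trans (IH _ EM) _; rewrite ltn_add2l proper_card //.
  apply/properP; split.
    apply/subsetP => -[a b]; rewrite !inE /=.
    by move=> /and4P[/andP[_ ->] /andP[_ ->] -> ->].
  by exists (i, j); rewrite !inE /= ?iM ?jM ?ij // eqxx.
rewrite negb_exists => /forallP noE; rewrite -En.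
apply: leq_trans (leq_addr _ _); apply: indep => i j iM jM ij.
by have := noE (i, j); rewrite /= iM jM ij.
Qed.

(** A family without compatible pairs makes the sets [A i] minus [B i] and [B i] cross-intersect, so
    it has at most [2 ^ q.-1] members; the surplus of [M] is paid for by compatible pairs. *)
Lemma many_compatible_pairs (T : eqType) (I : finType) (q : nat)
    (A B : I -> seq T) (M : {set I}) :
  (0 < q)%N -> (forall i, size (A i) + size (B i) <= q)%N ->
  (2 ^ q <= #|M|)%N ->
  (2 ^ q.-1 <= #|[set z : I * I | [&& z.1 \in M, z.2 \in M, z.1 != z.2
     & all (fun x => (x \in A z.1) ==> (x \in B z.1)) (B z.2)]]|)%N.
Proof.
move=> q0 leq leqM.
pose r i j := all (fun x => (x \in A i) ==> (x \in B i)) (B j).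
(* As [T] is only an [eqType], positions in the duplicate-free list of all occurring elements serve
   as the finite ground set. *)
pose U := flatten [seq A i ++ B i | i <- enum I].
have inU i x : (x \in A i) || (x \in B i) -> x \in U.
  move=> h; apply/flatten_mapP; exists i; first by rewrite mem_enum.
  by rewrite mem_cat.
have card_le (s : seq T) (t : {set 'I_(size (undup U))}) :
    (forall k, k \in t -> (tnth (in_tuple (undup U)) k) \in s) -> (#|t| <= size s)%N.
  move=> h; rewrite cardE -(size_map (tnth (in_tuple (undup U)))).
  apply: uniq_leq_size.
    rewrite map_inj_uniq ?enum_uniq //; apply/tuple_uniqP; exact: undup_uniq.
  by move=> x /mapP[k]; rewrite mem_enum => /h + ->.
pose X i : {set 'I_(size (undup U))} :=
  [set k | let x := tnth (in_tuple (undup U)) k in (x \in A i) && (x \notin B i)].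
pose Y i : {set 'I_(size (undup U))} :=
  [set k | tnth (in_tuple (undup U)) k \in B i].
have indep_le (J : {set I}) :
    (forall i j, i \in J -> j \in J -> i != j -> ~~ r i j) -> (#|J| <= 2 ^ q.-1)%N.
  move=> indep.
  apply: (@bollobas_card _ _ q J X Y) => // [i iJ|i iJ|i j iJ jJ ij].
  - rewrite -setI_eq0; apply/eqP/setP => k; rewrite !inE.
    by rewrite -andbA andNb andbF.
  - apply: leq_trans (leq i); apply: leq_add; apply: card_le => k; rewrite inE //.
    by case/andP.
  - have := indep i j iJ jJ ij; rewrite -has_predC => /hasP[x xB].
    rewrite /= negb_imply => /andP[xA xnB].
    have xU : x \in undup U by rewrite mem_undup (inU i) // xA.
    have [k xk] : exists k, x = tnth (in_tuple (undup U)) k.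
      by apply/tnthP.
    apply/pred0Pn; exists k; rewrite /= !inE -xk.
    by rewrite /= xA xnB xB.
have := leq_trans leqM (card_le_independent_edges indep_le M).
rewrite -{1}(prednK q0) expnS mul2n -addnn leq_add2l; exact.
Qed.

From mathcomp Require Import all_classical all_reals all_analysis.
From mathcomp Require Import measurable_realfun.
Import numFieldNormedType.Exports.

(** * Decision trees and finite tables of oracles *)

Definition query := {l : nat & l.-tuple bool}.

Definition mkquery (l : nat) (x : l.-tuple bool) : query :=
  Tagged (fun l => l.-tuple bool) x.

Definition answer (O : oracle) (x : query) : (tag x).-tuple bool :=
  O (tag x) (tagged x).

Fixpoint queries (O : oracle) (A : Type) (t : oalg A) : seq query :=
  match t with
  | Ret _ => [::]
  | Query l x k => mkquery x :: queries O (k (O l x))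
  end.

Lemma size_queries O A (t : oalg A) : size (queries O t) = nqueries O t.
Proof. by elim: t => //= l x k IH; rewrite IH. Qed.

Definition agree (s : seq query) (O O' : oracle) : Prop :=
  forall x, x \in s -> answer O x = answer O' x.

Lemma agree_catl s1 s2 O O' : agree (s1 ++ s2) O O' -> agree s1 O O'.
Proof. by move=> h x xs; apply: h; rewrite mem_cat xs. Qed.

Lemma agree_catr s1 s2 O O' : agree (s1 ++ s2) O O' -> agree s2 O O'.
Proof. by move=> h x xs; apply: h; rewrite mem_cat xs orbT. Qed.

Lemma agree_run (A : Type) (t : oalg A) O O' :
  agree (queries O t) O O' -> run O' t = run O t.
Proof.
elim: t => //= l x k IH h.
have e : O l x = O' l x by apply: (h (mkquery x)); rewrite mem_head.
by rewrite -e IH // => y ys; apply: h; rewrite inE ys orbT.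
Qed.

Lemma agree_queries (A : Type) (t : oalg A) O O' :
  agree (queries O t) O O' -> queries O' t = queries O t.
Proof.
elim: t => //= l x k IH h.
have e : O l x = O' l x by apply: (h (mkquery x)); rewrite mem_head.
by rewrite -e IH // => y ys; apply: h; rewrite inE ys orbT.
Qed.

(* The first query outside [s] is the same for all oracles that agree on [s]. *)
Lemma common_new_query (A : Type) (t : oalg A) (s : seq query) O :
  ~ {subset queries O t <= s} ->
  exists2 x, x \notin s & forall O', agree s O O' -> x \in queries O' t.
Proof.
elim: t => [a|l x k IH] /= h; first by case: h.
have [xs|xs] := boolP (mkquery x \in s); last first.
  by exists (mkquery x) => // O' _; rewrite mem_head.
have /IH[y ys hy] : ~ {subset queries O (k (O l x)) <= s}.
  by move=> sub; apply: h => y; rewrite inE => /orP[/eqP->//|/sub].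
exists y => // O' agO; rewrite inE.
have <- : O l x = O' l x by exact: (agO (mkquery x)).
by rewrite hy ?orbT.
Qed.

(** * Composition and simulation of decision trees *)

Fixpoint obind (A B : Type) (t : oalg A) (f : A -> oalg B) : oalg B :=
  match t with
  | Ret a => f a
  | Query l x k => Query x (fun y => obind (k y) f)
  end.

Lemma run_obind O A B (t : oalg A) (f : A -> oalg B) :
  run O (obind t f) = run O (f (run O t)).
Proof. by elim: t => //= l x k IH; rewrite IH. Qed.

Lemma queries_obind O A B (t : oalg A) (f : A -> oalg B) :
  queries O (obind t f) = queries O t ++ queries O (f (run O t)).
Proof. by elim: t => //= l x k IH; rewrite IH. Qed.

Definition overwrite (s : seq query) (O' O : oracle) : oracle :=
  fun l => [ffun x => if mkquery x \in s then O' l x else O l x].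

Lemma answer_overwrite s O' O x :
  answer (overwrite s O' O) x = if x \in s then answer O' x else answer O x.
Proof. by case: x => l x; rewrite /answer ffunE. Qed.

(** The replies of [O'] on [s] are built into the tree and cost no query. *)
Fixpoint simulate (s : seq query) (O' : oracle) (A : Type) (t : oalg A) :
    oalg A :=
  match t with
  | Ret a => Ret a
  | Query l x k =>
      if mkquery x \in s then simulate s O' (k (O' l x))
      else Query x (fun y => simulate s O' (k y))
  end.

Lemma run_simulate s O' O A (t : oalg A) :
  run O (simulate s O' t) = run (overwrite s O' O) t.
Proof. by elim: t => //= l x k IH; rewrite ffunE; case: ifP => _ /=; rewrite IH. Qed.

Lemma queries_simulate s O' O A (t : oalg A) :
  queries O (simulate s O' t) =
  [seq x <- queries (overwrite s O' O) t | x \notin s].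
Proof.
by elim: t => //= l x k IH; rewrite ffunE; case: ifP => _ /=; rewrite IH.
Qed.

(** * Bounded query lengths and finite tables *)

Definition short (L : nat) : pred query := fun x => (tag x < L)%N.

(** A query has finitely many answers, so the bounds of the subtrees have a maximum. This is what
    permits replacing oracles by finite tables. *)
Lemma oalg_short (A : Type) (t : oalg A) :
  exists L, forall O, all (short L) (queries O t).
Proof.
elim: t => [a|l x k IH]; first by exists 0.
have [Lf hL] := choice IH.
exists (maxn l.+1 (\max_(y : l.-tuple bool) Lf y)) => O /=.
rewrite /short /= leq_maxl /=; apply: sub_all (hL (O l x) O) => y.
move=> /leq_trans; apply; apply: leq_trans (leq_maxr _ _).
exact: (leq_bigmax (F := Lf)).
Qed.

Lemma short_le L L' x : (L <= L')%N -> short L x -> short L' x.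
Proof. by move=> h /leq_trans; apply. Qed.

Definition table (L : nat) := {dffun forall l : 'I_L, length_preserving l}.

(** The identity is an arbitrary default. Being common to all tables, it makes [answer_patch] hold
    for queries of every length. *)
Definition extend (L : nat) (F : table L) : oracle := fun l =>
  match ltnP l L with
  | LtnNotGeq h => F (Ordinal h)
  | GeqNotLtn _ => [ffun x => x]
  end.

Definition restrict (L : nat) (O : oracle) : table L := [ffun l : 'I_L => O l].

Lemma extend_restrict L O x :
  short L x -> answer (extend (restrict L O)) x = answer O x.
Proof.
case: x => l x; rewrite /short /answer /extend /=.
by case: (ltnP l L) => // h _; rewrite ffunE.
Qed.

Lemma agree_restrict L O s :
  all (short L) s -> agree s (extend (restrict L O)) O.
Proof. by move=> /allP h x /h; exact: extend_restrict. Qed.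

Definition patch (L : nat) (s : seq query) (F' F : table L) : table L :=
  restrict L (overwrite s (extend F') (extend F)).

Lemma answer_patch L s (F' F : table L) x :
  answer (extend (patch s F' F)) x =
  if x \in s then answer (extend F') x else answer (extend F) x.
Proof.
have [xL|] := boolP (short L x).
  by rewrite extend_restrict // answer_overwrite.
case: x => l x; rewrite /short /answer /extend /=.
by case: (ltnP l L) => // h _; case: ifP.
Qed.

Lemma eq_table L (F F' : table L) :
  (forall x, answer (extend F) x = answer (extend F') x) -> F = F'.
Proof.
move=> h; apply/ffunP => -[l hl]; apply/ffunP => x.
have := h (mkquery x); rewrite /answer /extend /=.
case: ltnP => [hl'|]; last by rewrite leqNgt hl.
by rewrite (bool_irrelevance hl' hl).
Qed.

Lemma ler_sum_inj (R : numDomainType) (I J : finType) (P : pred I) (Q : pred J)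
    (f : I -> J) (F : I -> R) (G : J -> R) :
  {in P &, injective f} -> (forall i, P i -> Q (f i)) ->
  (forall i, P i -> F i = G (f i)) -> (forall j, Q j -> 0 <= G j) ->
  \sum_(i | P i) F i <= \sum_(j | Q j) G j.
Proof.
move=> finj PQ FG G0; rewrite (eq_bigr _ FG).
rewrite (eq_bigl (mem [set i | P i]%SET)); last by move=> i /=; rewrite inE.
rewrite -(big_imset G (h := f)) /=; last first.
  by move=> i j; rewrite !inE; exact: finj.
rewrite [leRHS](bigID (mem (f @: [set i | P i]%SET))) /= [leLHS]big_mkcond.
rewrite [X in _ <= X + _](_ : _ = \sum_j if j \in f @: [set i | P i]%SET then G j else 0).
  by rewrite lerDl sumr_ge0 // => j /andP[/G0].
rewrite -big_mkcond; apply: eq_bigl => j; rewrite andbC; case: imsetP => //= -[i].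
by rewrite inE => Pi ->; rewrite PQ.
Qed.

(** * The attack on two fixed messages *)

Section Queries.
Variables (R : realType) (n : nat) (Sch : signature_scheme R n).
Implicit Types (O : oracle) (c : nat) (a : n.-tuple bool).

Definition skey O c := (run O (exec (gen Sch) c)).1.
Definition vkey O c := (run O (exec (gen Sch) c)).2.
Definition sig O c a := run O (sign Sch (skey O c) a).
Definition genq O c := queries O (exec (gen Sch) c).
Definition signq O c a := queries O (sign Sch (skey O c) a).
Definition verq O c a := queries O (ver Sch (vkey O c) a (sig O c a)).
Definition secretq O c a := genq O c ++ signq O c a.

Lemma total_queriesE O c a :
  total_queries Sch O c a = (size (secretq O c a) + size (verq O c a))%N.
Proof.
rewrite /total_queries /secretq /verq /genq /signq /sig /skey /vkey size_cat.
by rewrite !size_queries; case: (run O _).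
Qed.

Lemma agree_skey O O' c : agree (genq O c) O O' -> skey O' c = skey O c.
Proof. by move=> h; rewrite /skey (agree_run h). Qed.

Lemma agree_vkey O O' c : agree (genq O c) O O' -> vkey O' c = vkey O c.
Proof. by move=> h; rewrite /vkey (agree_run h). Qed.

Lemma agree_signq O O' c a :
  agree (genq O c) O O' -> agree (signq O c a) O O' ->
  signq O' c a = signq O c a.
Proof. by move=> h k; rewrite /signq (agree_skey h) (agree_queries k). Qed.

Lemma agree_sig O O' c a :
  agree (genq O c) O O' -> agree (signq O c a) O O' -> sig O' c a = sig O c a.
Proof. by move=> h k; rewrite /sig (agree_skey h) (agree_run k). Qed.

Lemma agree_verq O O' c a :
  agree (genq O c) O O' -> agree (signq O c a) O O' ->
  agree (verq O c a) O O' -> verq O' c a = verq O c a.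
Proof.
by move=> h k l; rewrite /verq (agree_vkey h) (agree_sig h k) (agree_queries l).
Qed.

Lemma agree_secretq O O' c a :
  agree (secretq O c a) O O' -> secretq O' c a = secretq O c a.
Proof.
move=> h; have hl := agree_catl h; have hr := agree_catr h.
by rewrite /secretq (agree_signq hl hr) /genq (agree_queries hl).
Qed.

(** [Gen], [Sign] and [Ver] are composed into one tree for each coin and message; cutting the coins
    at [m] leaves finitely many trees, hence a common bound. *)
Lemma scheme_short m :
  exists L, forall c, (c < m)%N -> forall O a,
    all (short L) (secretq O c a ++ verq O c a).
Proof.
pose tree c a := obind (exec (gen Sch) c) (fun k =>
  obind (sign Sch k.1 a) (fun s => ver Sch k.2 a s)).
have treeE O c a : queries O (tree c a) = secretq O c a ++ verq O c a.
  by rewrite !queries_obind -catA.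
have /choice[Lf hL] : forall z : 'I_m * n.-tuple bool, exists L, forall O,
  all (short L) (queries O (tree z.1 z.2)) by move=> z; exact: oalg_short.
exists (\max_z Lf z) => c cm O a.
rewrite -treeE; apply: sub_all (hL (Ordinal cm, a) O) => x.
by apply: short_le; exact: (leq_bigmax (F := Lf)).
Qed.

End Queries.

(** * Worlds, the exchange of answers and the learning phase *)

Section Attack.
Variables (R : realType) (n : nat) (Sch : signature_scheme R n).
Variables (q m L : nat) (p : 'I_m -> R).
Hypothesis q_gt0 : (0 < q)%N.
Hypothesis p_ge0 : forall c, 0 <= p c.
Hypothesis complete : forall (c : 'I_m) O a, 0 < p c ->
  run O (ver Sch (vkey Sch O c) a (sig Sch O c a)) = true.
Hypothesis few_queries : forall (c : 'I_m) O a, 0 < p c ->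
  (size (secretq Sch O c a) + size (verq Sch O c a) <= q)%N.
Hypothesis short_queries : forall (c : 'I_m) O a,
  all (short L) (secretq Sch O c a ++ verq Sch O c a).
Variables a b : n.-tuple bool.
Hypothesis neq_ba : b != a.

(** All tables are equally likely, so [p] of the coins is, up to normalisation, the weight of a
    world. *)
Local Notation world := ('I_m * table L)%type.
Implicit Types (w : world) (W : {set world}) (known : seq query).

Definition world_view w : bits * bits :=
  (vkey Sch (extend w.2) w.1, sig Sch (extend w.2) w.1 a).

Definition forgery_game (vk : bits) (t : oalg (n.-tuple bool * bits)) :=
  obind t (fun f => obind (ver Sch vk f.1 f.2) (fun r => Ret ((f.1 != a) && r))).

(* The second conjunct lets a win on a table be carried over to all the oracles
   that extend it. *)
Definition wins (vk : bits) (t : oalg (n.-tuple bool * bits)) w : bool :=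
  run (extend w.2) (forgery_game vk t) &&
  all (short L) (queries (extend w.2) (forgery_game vk t)).

(* [W] is the set of the possible worlds in the eyes of an adversary that was
   given [v] and has asked the queries of [known]. *)
Record knowledge (v : bits * bits) known W : Prop := {
  knowledge_pos : forall w, w \in W -> 0 < p w.1 ;
  knowledge_view : forall w, w \in W -> world_view w = v ;
  knowledge_agree : forall w w', w \in W -> w' \in W ->
    agree known (extend w.2) (extend w'.2) ;
  knowledge_closed : forall w F', w \in W -> world_view (w.1, F') = v ->
    agree known (extend w.2) (extend F') -> (w.1, F') \in W }.

Definition secrets w := secretq Sch (extend w.2) w.1 a.

(* The adversary signs [b] as the world [w] would, with the private queries
   of [w] answered as in [w] and all the others by the true oracle. *)
Definition attack w : oalg (n.-tuple bool * bits) :=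
  obind (simulate (secrets w) (extend w.2) (sign Sch (skey Sch (extend w.2) w.1) b))
        (fun s => Ret (b, s)).

Definition usedq w :=
  signq Sch (extend w.2) w.1 b ++ verq Sch (extend w.2) w.1 b.

(** The queries whose answers get exchanged: on [known] the true and the picked world agree already,
    and on the secrets of the picked world the attack replies by itself. *)
Definition newq known w :=
  [seq x <- usedq w | (x \notin secrets w) && (x \notin known)].

(** Verification runs on the true oracle, without the simulated replies, so a secret that [Ver b]
    asks must be one on which both worlds are known to agree. *)
Definition compatible known w : bool :=
  all (fun x => (x \in secrets w) ==> (x \in known))
      (verq Sch (extend w.2) w.1 b).

Definition clean known w w' : bool :=
  all (fun x => x \notin secrets w) (newq known w').

Definition exchange (s : seq query) (z : world * world) : world * world :=
  ((z.1.1, patch s z.2.2 z.1.2), (z.2.1, patch s z.1.2 z.2.2)).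

Definition swap known (z : world * world) : world * world :=
  exchange (newq known z.2) z.

(** Recovers the exchanged set from the pair after the exchange, by rerunning [Sign b] and [Ver b]
    on the oracle [H] that the attack sees there. This makes the exchange injective. *)
Definition swapped_newq known (z : world * world) :=
  let H := overwrite (secrets z.2) (extend z.2.2) (extend z.1.2) in
  [seq x <- signq Sch H z.2.1 b ++ verq Sch H z.2.1 b
         | (x \notin secrets z.2) && (x \notin known)].

Lemma agree_world_view w (F' : table L) :
  agree (secrets w) (extend w.2) (extend F') ->
  world_view (w.1, F') = world_view w.
Proof.
move=> h; have hl := agree_catl h; have hr := agree_catr h.
by rewrite /world_view /= (agree_vkey hl) (agree_sig hl hr).
Qed.

Section Swap.
Variables (v : bits * bits) (known : seq query) (W : {set world}).
Hypothesis knowW : knowledge v known W.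
Variables (w w' : world).
Hypotheses (wW : w \in W) (w'W : w' \in W).
Hypotheses (compat : compatible known w') (cl : clean known w w').

Let s := newq known w'.
Let w1 := (swap known (w, w')).1.
Let w1' := (swap known (w, w')).2.
(** Here [w] is the true world and [w'] the picked one; [H] is the oracle on which [attack w1']
    signs when it runs in [w1]. *)
Let H := overwrite (secrets w1') (extend w1'.2) (extend w1.2).

Let s_known x : x \in known -> x \notin s.
Proof. by move=> xk; rewrite mem_filter xk andbF. Qed.

Let s_secret x : x \in secrets w' -> x \notin s.
Proof. by move=> xk; rewrite mem_filter xk. Qed.

Let s_clean x : x \in secrets w -> x \notin s.
Proof. by move=> xw; apply: contraTN xw => /(allP cl). Qed.

Let agree_secrets_w1 : agree (secrets w) (extend w.2) (extend w1.2).
Proof. by move=> x /s_clean; rewrite answer_patch => /negPf ->. Qed.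

Let agree_secrets_w1' : agree (secrets w') (extend w'.2) (extend w1'.2).
Proof. by move=> x /s_secret; rewrite answer_patch => /negPf ->. Qed.

Let secrets_w1' : secrets w1' = secrets w'.
Proof. exact: agree_secretq. Qed.

Let agree_known : agree known (extend w.2) (extend w'.2).
Proof. exact: knowledge_agree knowW _ _ _ _. Qed.

Let swap_usedq x : x \in usedq w' -> x \notin secrets w' ->
  answer (extend w'.2) x = answer (extend w1.2) x.
Proof.
move=> xu xs; rewrite answer_patch; case: ifPn => // xns.
have xk : x \in known.
  by apply: contraNT xns => xk; rewrite mem_filter xs xk.
by rewrite agree_known.
Qed.

Let agree_secrets_H : agree (secrets w') (extend w'.2) H.
Proof. by move=> x xs; rewrite answer_overwrite secrets_w1' xs agree_secrets_w1'. Qed.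

Let agree_used_H : agree (usedq w') (extend w'.2) H.
Proof.
move=> x xu; rewrite answer_overwrite secrets_w1'; case: ifPn => xs.
  exact: agree_secrets_w1'.
exact: swap_usedq.
Qed.

Let agree_ver_w1 :
  agree (verq Sch (extend w'.2) w'.1 b) (extend w'.2) (extend w1.2).
Proof.
move=> x xv; have [xs|xs] := boolP (x \in secrets w'); last first.
  by rewrite swap_usedq // mem_cat xv orbT.
have xk : x \in known by have := allP compat _ xv; rewrite xs.
by rewrite answer_patch (negPf (s_known xk)) agree_known.
Qed.

(** The exchanged queries avoid [known] and the secrets of both worlds, so both views persist and
    [knowledge_closed] applies. *)
Lemma swap_mem : (w1 \in W) && (w1' \in W).
Proof.
apply/andP; split.
  apply: (knowledge_closed knowW wW).
    by rewrite (agree_world_view agree_secrets_w1) (knowledge_view knowW wW).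
  by move=> x /s_known; rewrite answer_patch => /negPf ->.
apply: (knowledge_closed knowW w'W).
  by rewrite (agree_world_view agree_secrets_w1') (knowledge_view knowW w'W).
by move=> x /s_known; rewrite answer_patch => /negPf ->.
Qed.

(** After the exchange, the attack and the verifier meet exactly the answers of [w']: the run is an
    honest signature of [b] in [w'], accepted by perfect completeness. *)
Lemma swap_wins : wins v.1 (attack w1') w1.
Proof.
have gagree : agree (genq Sch (extend w'.2) w'.1) (extend w'.2) (extend w1'.2).
  exact: agree_catl agree_secrets_w1'.
have -> : v.1 = vkey Sch (extend w'.2) w'.1.
  by rewrite -(knowledge_view knowW w'W).
have sigE : run H (sign Sch (skey Sch (extend w1'.2) w1'.1) b) =
            sig Sch (extend w'.2) w'.1 b.
  by rewrite (agree_skey gagree) (agree_run (agree_catl agree_used_H)).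
rewrite /wins /forgery_game !run_obind !queries_obind !run_simulate /= -/H.
rewrite sigE neq_ba /= (agree_run agree_ver_w1) complete ?(knowledge_pos knowW) //=.
rewrite !run_obind run_simulate /= -/H sigE (agree_queries agree_ver_w1).
rewrite queries_simulate -/H (agree_skey gagree) (agree_queries (agree_catl agree_used_H)).
have := short_queries w'.1 (extend w'.2) b.
rewrite !all_cat /= !andbT all_filter => /andP[/andP[_ sh] ->]; rewrite andbT.
by apply: sub_all sh => x sx; apply/implyP.
Qed.

Lemma swapped_newqE : swapped_newq known (swap known (w, w')) = newq known w'.
Proof.
have agg := agree_catl agree_secrets_H.
have ags := agree_catl agree_used_H.
rewrite /swapped_newq -/w1 -/w1' -/H secrets_w1'.
by rewrite (agree_signq agg ags) (agree_verq agg ags (agree_catr agree_used_H)).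
Qed.

End Swap.

Lemma exchangeK s : involutive (exchange s).
Proof.
case=> -[c F] [c' F']; rewrite /exchange /=.
by congr ((_, _), (_, _)); apply: eq_table => x; rewrite !answer_patch; case: (x \in s).
Qed.

Local Notation mass W := (\sum_(w in W) p w.1).

Definition allq w := secrets w ++ verq Sch (extend w.2) w.1 a.

(** The exchange keeps the coins, hence the weights, and sends compatible clean pairs to winning
    pairs. It is injective, since the image determines the exchanged set and an exchange on a fixed
    set is an involution. *)
Lemma swap_sum v known W : knowledge v known W ->
  \sum_(w' in W) \sum_(w in W)
     p w.1 * p w'.1 * (compatible known w' && clean known w w')%:R <=
  \sum_(w' in W) \sum_(w in W) p w.1 * p w'.1 * (wins v.1 (attack w') w)%:R.
Proof.
move=> knowW; rewrite !pair_big /=.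
have restr (f : world * world -> bool) :
    \sum_(z | (z.1 \in W) && (z.2 \in W)) p z.2.1 * p z.1.1 * (f z)%:R =
    \sum_(z | (z.1 \in W) && (z.2 \in W) && f z) p z.2.1 * p z.1.1.
  rewrite [RHS]big_mkcondr /=; apply: eq_bigr => z _.
  by case: (f z); rewrite ?mulr1 ?mulr0.
rewrite (restr (fun z => compatible known z.1 && clean known z.2 z.1)).
rewrite (restr (fun z => wins v.1 (attack z.1) z.2)).
pose flip (z : world * world) := (z.2, z.1).
have flipK : involutive flip by case.
apply: (@ler_sum_inj _ _ _ _ _ (fun z => flip (swap known (flip z)))) => /=.
- move=> z y /andP[/andP[z1 z2] /andP[zc zl]] /andP[/andP[y1 y2] /andP[yc yl]] eqf.
  have {}eqf : swap known (flip z) = swap known (flip y).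
    exact: (can_inj flipK).
  have Es : newq known z.1 = newq known y.1.
    have <- := swapped_newqE knowW z2 z1.
    have <- := swapped_newqE knowW y2 y1.
    by rewrite eqf.
  apply: (can_inj flipK); apply: (can_inj (exchangeK (newq known y.1))).
  by rewrite -[in LHS]Es.
- move=> [w' w] /andP[/= /andP[w'W wW] /andP[cm cl]].
  have /andP[-> ->] := swap_mem knowW wW w'W cl.
  by rewrite (swap_wins knowW wW w'W cm).
- by [].
- by move=> z _; rewrite mulr_ge0.
Qed.

(** Union bound: [w'] has at most [q] new queries, and each is secret in at most a fraction
    [1 / (2q)] of [W]. *)
Lemma clean_mass v known W w' : knowledge v known W -> w' \in W ->
  (forall x, x \notin known ->
     \sum_(w in W | x \in allq w) p w.1 <= (2 * q%:R)^-1 * mass W) ->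
  2^-1 * mass W <= \sum_(w in W) p w.1 * (clean known w w')%:R.
Proof.
move=> knowW w'W light.
have lb w : p w.1 * (1 - \sum_(x <- newq known w') (x \in allq w)%:R) <=
            p w.1 * (clean known w w')%:R.
  rewrite ler_wpM2l //; case: (boolP (clean known w w')) => [_|].
    by rewrite lerBlDr lerDl sumr_ge0.
  rewrite /clean -has_predC => /hasP[x xs /negPn xw].
  rewrite lerBlDr add0r (big_rem x) //= mem_cat xw /= lerDl sumr_ge0 //.
apply: le_trans (ler_sum _ (fun w _ => lb w)).
rewrite [leRHS](_ : _ = mass W -
  \sum_(x <- newq known w') \sum_(w in W) p w.1 * (x \in allq w)%:R); last first.
  rewrite exchange_big -sumrB; apply: eq_bigr => w _.
  by rewrite mulrBr mulr1 mulr_sumr.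
have q0 : 0 < q%:R :> R by rewrite ltr0n.
have m0 : 0 <= mass W by rewrite sumr_ge0.
have : \sum_(x <- newq known w') \sum_(w in W) p w.1 * (x \in allq w)%:R <=
       \sum_(x <- newq known w') (2 * q%:R)^-1 * mass W.
  rewrite big_seq [leRHS]big_seq; apply: ler_sum => x.
  rewrite mem_filter -andbA => /and3P[_ xk _].
  apply: le_trans (light x xk); rewrite big_mkcondr /=; apply: ler_sum => w _.
  by case: ifP; rewrite ?mulr1 ?mulr0.
rewrite big_const_seq count_predT iter_addr addr0 => h.
have : (size (newq known w') <= q)%N.
  rewrite size_filter (leq_trans (count_size _ _)) //.
  apply: leq_trans (few_queries (extend w'.2) b (knowledge_pos knowW w'W)).
  by rewrite !size_cat leq_add2r leq_addl.
rewrite -(ler_nat R) => hs.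
have : (2 * q%:R)^-1 * mass W *+ size (newq known w') <= 2^-1 * mass W.
  rewrite -mulr_natr mulrAC ler_wpM2r //.
  by rewrite invfM -mulrA ger_pMr ?invr_gt0 // ler_pdivrMl // mulr1.
move=> h2; have := le_trans h h2; lra.
Qed.

(** The simulated signing is a genuine run of the scheme with the coins of [w], on an oracle that
    agrees with [w] on its secrets. *)
Lemma attack_few_queries w O : 0 < p w.1 -> (nqueries O (attack w) <= q)%N.
Proof.
move=> pw; rewrite -size_queries queries_obind cats0 queries_simulate.
rewrite size_filter (leq_trans (count_size _ _)) //.
set H := overwrite _ _ _.
have agH : agree (secrets w) (extend w.2) H.
  by move=> x xs; rewrite answer_overwrite xs.
have <- := agree_skey (agree_catl agH).
apply: leq_trans (few_queries H b pw).
by rewrite !size_cat -addnA addnCA leq_addr.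
Qed.

(** By averaging over the picked world, some fixed [w'] does at least as well as a random one:
    otherwise [swap_sum] and [clean_mass] contradict each other. *)
Lemma final_attack v known W : knowledge v known W -> 0 < mass W ->
  (forall x, x \notin known ->
     \sum_(w in W | x \in allq w) p w.1 <= (2 * q%:R)^-1 * mass W) ->
  exists t, (forall O, nqueries O t <= q)%N /\
    2^-1 * (\sum_(w in W) p w.1 * (compatible known w)%:R) <=
    \sum_(w in W) p w.1 * (wins v.1 t w)%:R.
Proof.
move=> knowW m0 light; set B := 2^-1 * _.
have [/existsP[w' /andP[w'W hw]]|] := boolP [exists w', (w' \in W) &&
    (B <= \sum_(w in W) p w.1 * (wins v.1 (attack w') w)%:R)].
  exists (attack w'); split=> // O; apply: attack_few_queries.
  exact: knowledge_pos knowW w' w'W.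
rewrite negb_exists => /forallP no; exfalso.
have := swap_sum knowW; apply/negP; rewrite -ltNge.
apply: (@lt_le_trans _ _ (mass W * B)).
  have [w0 w0W] : exists w0, w0 \in W.
    apply/existsP; apply: contraTT m0; rewrite negb_exists => /forallP W0.
    by rewrite big1 ?ltxx // => w wW; have := W0 w; rewrite wW.
  rewrite mulr_suml; apply: ltr_sum => [|w' w'W].
    by apply/hasP; exists w0; rewrite ?mem_index_enum.
  under eq_bigr => w _ do rewrite mulrAC mulrC.
  rewrite -mulr_sumr ltr_pM2l ?(knowledge_pos knowW) //.
  by have := no w'; rewrite w'W /= -ltNge.
rewrite /B mulrCA mulr_sumr mulr_sumr; apply: ler_sum => w' w'W.
case: (compatible known w'); last first.
  by rewrite !mulr0 sumr_ge0 // => w _; rewrite mulr0.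
rewrite mulr1 [leRHS](_ : _ = p w'.1 * \sum_(w in W) p w.1 * (clean known w w')%:R).
  by rewrite [mass W * _]mulrC mulrCA ler_wpM2l // (clean_mass knowW).
by rewrite mulr_sumr; apply: eq_bigr => w _; rewrite mulrAC mulrC.
Qed.

(** This is [compatible] with the queries of [Ver a] for [known]; it depends on the world alone and
    is what the set-pairs count provides. *)
Definition forgeable w : bool :=
  all (fun x => (x \in secrets w) ==> (x \in verq Sch (extend w.2) w.1 a))
      (verq Sch (extend w.2) w.1 b).

(** The offset [q] keeps the potential at least the mass of [W], so what is left of it when the
    steps run out bounds the loss. *)
Definition potential known W : R :=
  \sum_(w in W) p w.1 * (q + count (fun x => x \notin known) (allq w))%:R.

Lemma size_allq w : 0 < p w.1 -> (size (allq w) <= q)%N.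
Proof. by move=> pw; rewrite size_cat few_queries. Qed.

Lemma potential_le v known W : knowledge v known W ->
  potential known W <= 2 * q%:R * mass W.
Proof.
move=> knowW; rewrite mulr_sumr; apply: ler_sum => w wW.
rewrite mulrC ler_wpM2r // -natrM ler_nat mul2n -addnn leq_add2l.
exact: leq_trans (count_size _ _) (size_allq (knowledge_pos knowW wW)).
Qed.

(** Asking [x] removes an unknown query from a fraction [1 / (2q)] of the mass, while the potential
    is at most [2q] times the mass. *)
Lemma potential_query v known W x : knowledge v known W -> x \notin known ->
  (2 * q%:R)^-1 * mass W <= \sum_(w in W | x \in allq w) p w.1 ->
  potential (x :: known) W <= (1 - (4 * q%:R ^+ 2)^-1) * potential known W.
Proof.
move=> knowW xk heavy.
have q0 : 0 < q%:R :> R by rewrite ltr0n.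
have : potential (x :: known) W <=
       potential known W - \sum_(w in W | x \in allq w) p w.1.
  rewrite big_mkcondr /= lerBrDr -big_split /=; apply: ler_sum => w wW.
  have -> : (if x \in allq w then p w.1 else 0) = p w.1 * (x \in allq w)%:R.
    by case: ifP; rewrite ?mulr1 ?mulr0.
  rewrite -mulrDr ler_wpM2l // -natrD ler_nat -addnA leq_add2l.
  elim: (allq w) => //= y s IH; rewrite !inE negb_or (eq_sym x y).
  case: (y =P x) => [->|_] /=; last by rewrite -addnA leq_add2l.
  by rewrite xk; move: IH; case: (x \in s) => /=; lia.
move=> h1; have h2 := potential_le knowW.
have h3 : (4 * q%:R ^+ 2)^-1 * potential known W <= (2 * q%:R)^-1 * mass W.
  rewrite ler_pdivrMl ?mulr_gt0 ?exprn_gt0 //; apply: le_trans h2 _.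
  rewrite le_eqVlt; apply/orP; left; apply/eqP.
  by field; rewrite gt_eqF.
lra.
Qed.

Lemma knowledge_query v known W x (y : (tag x).-tuple bool) :
  knowledge v known W ->
  knowledge v (x :: known) [set w in W | answer (extend w.2) x == y]%SET.
Proof.
move=> [k1 k2 k3 k4]; split=> [w|w|w w'|w F'].
- by rewrite inE => /andP[/k1].
- by rewrite inE => /andP[/k2].
- rewrite !inE => /andP[wW /eqP wy] /andP[w'W /eqP wy'] z.
  by rewrite inE => /orP[/eqP ->|/k3]; [rewrite wy wy'|exact].
- rewrite !inE => /andP[wW /eqP wy] vF ag.
  rewrite (k4 w) //=; last by move=> z zk; apply: ag; rewrite inE zk orbT.
  by rewrite -ag ?mem_head // wy.
Qed.

(** Induction on the number [k] of steps left: ask a heavy query if there is one and split [W] by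
    its answer, otherwise launch the final attack. *)
Lemma learn v k known W : knowledge v known W ->
  exists t, (forall O, nqueries O t <= k + q)%N /\
    2^-1 * (\sum_(w in W) p w.1 * (forgeable w)%:R) -
      (1 - (4 * q%:R ^+ 2)^-1) ^+ k * potential known W <=
    \sum_(w in W) p w.1 * (wins v.1 t w)%:R.
Proof.
have q0 : 1 <= q%:R :> R by rewrite ler1n.
have rho0 : 0 <= 1 - (4 * q%:R ^+ 2)^-1 :> R.
  rewrite subr_ge0 invf_le1; last by rewrite mulr_gt0 // exprn_gt0 // (lt_le_trans ltr01).
  by rewrite -[leLHS]mul1r ler_pM ?ler1n // exprn_ege1.
elim: k known W => [|k IH] known W knowW.
  (* Out of steps, any output will do: the claimed lower bound is at most zero. *)
  exists (Ret (a, [::])); split=> //; rewrite expr0 mul1r.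
  apply: (@le_trans _ _ 0); last by rewrite sumr_ge0 // => w _; rewrite mulr_ge0.
  rewrite subr_le0 mulr_sumr; apply: ler_sum => w wW; rewrite mulrCA ler_wpM2l //.
  apply: (@le_trans _ _ 1); last by rewrite ler1n addn_gt0 q_gt0.
  by case: forgeable; rewrite ?mulr1 ?mulr0 // invf_le1 ?ler1n.
have [/existsP[w0 w0W]|] := boolP [exists w, w \in W]; last first.
  rewrite negb_exists => /forallP W0; exists (Ret (a, [::])); split=> //.
  have e f : \sum_(w in W) f w = 0 :> R.
    by rewrite big1 // => w wW; have := W0 w; rewrite wW.
  by rewrite /potential !e !mulr0 subr0.
have m0 : 0 < mass W.
  rewrite (bigD1 w0) //= ltr_wpDr ?sumr_ge0 //; exact: knowledge_pos knowW w0 w0W.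
have [[x xk heavy]|light] := pselect (exists2 x, x \notin known &
    (2 * q%:R)^-1 * mass W <= \sum_(w in W | x \in allq w) p w.1).
  (* [wins] demands short queries; a heavy [x] has positive weight, so it is asked in some world of
     [W]. *)
  have xL : short L x.
    have [/existsP[w /andP[wW xw]]|] := boolP [exists w, (w \in W) && (x \in allq w)].
      by apply: (allP (short_queries w.1 (extend w.2) a)).
    rewrite negb_exists => /forallP W0; move: heavy; rewrite [leRHS]big1.
      by rewrite leNgt mulr_gt0 // invr_gt0 mulr_gt0 // (lt_le_trans ltr01).
    by move=> w hw; have := W0 w; rewrite hw.
  pose Wy (y : (tag x).-tuple bool) :=
    [set w in W | answer (extend w.2) x == y]%SET.
  have /choice[t ht] : forall y, exists t, (forall O, nqueries O t <= k + q)%N /\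
    2^-1 * (\sum_(w in Wy y) p w.1 * (forgeable w)%:R) -
      (1 - (4 * q%:R ^+ 2)^-1) ^+ k * potential (x :: known) (Wy y) <=
    \sum_(w in Wy y) p w.1 * (wins v.1 t w)%:R.
    by move=> y; apply: IH; exact: knowledge_query.
  have part f : \sum_(w in W) f w = \sum_y \sum_(w in Wy y) f w :> R.
    rewrite (partition_big (fun w => answer (extend w.2) x) predT) //=.
    by apply: eq_bigr => y _; apply: eq_bigl => w; rewrite inE.
  exists (Query (tagged x) t); split=> [Or|].
    by rewrite /= addSn ltnS; case: (ht (Or (tag x) (tagged x))).
  rewrite [leRHS]part.
  apply: (@le_trans _ _ (\sum_y
     (2^-1 * (\sum_(w in Wy y) p w.1 * (forgeable w)%:R) -
      (1 - (4 * q%:R ^+ 2)^-1) ^+ k * potential (x :: known) (Wy y)))).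
    have potE : \sum_y potential (x :: known) (Wy y) = potential (x :: known) W.
      by rewrite /potential part.
    rewrite sumrB -!mulr_sumr potE -part lerD2l lerN2 [_ ^+ k.+1]exprSr -mulrA.
    by rewrite ler_wpM2l ?exprn_ge0 // (potential_query knowW xk heavy).
  apply: ler_sum => y _; case: (ht y) => _ /le_trans; apply.
  apply: ler_sum => w; rewrite inE => /andP[_ /eqP wy].
  rewrite ler_wpM2l // ler_nat /wins /=.
  have -> : extend w.2 (tag x) (tagged x) = y by [].
  by have -> : short L (mkquery (tagged x)).
have {}light x : x \notin known ->
    \sum_(w in W | x \in allq w) p w.1 <= (2 * q%:R)^-1 * mass W.
  by move=> xk; rewrite leNgt; apply/negP; move/ltW => h; apply: light; exists x.
have [t [tq th]] := final_attack knowW m0 light.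
exists t; split=> [Or|]; first by rewrite (leq_trans (tq Or)) // leq_addl.
have pot0 : 0 <= potential known W by rewrite sumr_ge0 // => w _; rewrite mulr_ge0.
apply: le_trans th; rewrite lerBlDr ler_wpDr ?mulr_ge0 ?exprn_ge0 //.
rewrite ler_pM2l ?invr_gt0 //; apply: ler_sum => w wW; rewrite ler_wpM2l // ler_nat.
(* All worlds of [W] share the view, hence the tree of [Ver a]. Its first unknown query would be
   common to all of them and have full mass, which exceeds the fraction [1 / (2q)]. *)
have sub : {subset verq Sch (extend w.2) w.1 a <= known}.
  apply: contrapT => /common_new_query[x xk hx].
  have := light x xk; rewrite (eq_bigl (mem W)).
    rewrite -[leLHS]mul1r ler_pM2r // leNgt invf_lt1 ?mulr_gt0 ?(lt_le_trans ltr01 q0) //.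
    by rewrite -natrM ltr1n mul2n -addnn (leq_add q_gt0 q_gt0).
  move=> w' /=; case w'W: (w' \in W) => //=; rewrite mem_cat; apply/orP; right.
  rewrite /verq; have [-> ->] : (vkey Sch (extend w'.2) w'.1, sig Sch (extend w'.2) w'.1 a) =
    (vkey Sch (extend w.2) w.1, sig Sch (extend w.2) w.1 a).
    by rewrite -/(world_view w) -/(world_view w') !(knowledge_view knowW).
  exact/hx/(knowledge_agree knowW).
case: (boolP (forgeable w)) => // fw; rewrite lt0b.
by apply: sub_all fw => x /implyP h; apply/implyP => /h /sub.
Qed.
End Attack.

(** * The choice of the messages *)

(** [V] may be infinite, so the fibres are indexed by chosen representatives [r i] in [I]. *)
Lemma sum_fibers_ge0 (R : numDomainType) (I : finType) (V : eqType) (S : pred I)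
    (h : I -> V) (G : V -> I -> R) :
  (forall v, 0 <= \sum_(i | S i && (h i == v)) G v i) ->
  0 <= \sum_(i | S i) G (h i) i.
Proof.
move=> G0; pose r i := odflt i [pick j | h j == h i].
have hr i : h (r i) = h i.
  by rewrite /r; case: pickP => [j /eqP //|/(_ i)]; rewrite eqxx.
have rr i j : h i = h j -> r i = r j.
  by move=> e; rewrite /r e; case: pickP => // /(_ j); rewrite eqxx.
rewrite (partition_big r predT) //= sumr_ge0 // => j _.
rewrite (eq_bigr (G (h j))); last by move=> i /andP[_ /eqP <-]; rewrite hr.
have [ej|nej] := eqVneq (r j) j.
  rewrite (eq_bigl (fun i => S i && (h i == h j))) // => i.
  congr andb; apply/eqP/eqP => [<-|/rr ->//]; by rewrite hr.
rewrite big_pred0 // => i; apply/andP => -[_ /eqP e].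
by move/eqP: nej; apply; rewrite -[RHS]e; apply: rr; rewrite -e hr.
Qed.

Lemma exists_card_set (T : finType) (k : nat) :
  (k <= #|T|)%N -> exists M : {set T}, #|M| = k.
Proof.
move=> kT; exists [set x in take k (enum T)]%SET.
rewrite cardsE (card_uniqP _) ?take_uniq ?enum_uniq // size_take -cardE.
by case: ltngtP kT.
Qed.

Lemma expr_1subV_le (R : realFieldType) (N : nat) :
  (1 < N)%N -> (1 - N%:R^-1) ^+ N <= 2^-1 :> R.
Proof.
case: N => [|[|N]] // _; set M := N.+1.
have M0 : 0 < M%:R :> R by rewrite ltr0n.
(* With this form, Bernoulli's inequality gives [(1 + 1/M) ^ (M + 1) >= 1 + (M + 1)/M >= 2]. *)
have e : 1 - M.+1%:R^-1 = (1 + M%:R^-1)^-1 :> R.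
  by rewrite -natr1; field; rewrite gt_eqF //= natr1 pnatr_eq0.
rewrite e exprVn lef_pV2 ?posrE ?exprn_gt0 ?addr_gt0 ?invr_gt0 //.
have bern k : 1 + k%:R * M%:R^-1 <= (1 + M%:R^-1) ^+ k :> R.
  elim: k => [|k IH]; first by rewrite mul0r addr0 expr0.
  rewrite exprS; apply: le_trans (ler_wpM2l _ IH); last by rewrite addr_ge0 // invr_ge0 ltW.
  rewrite -natr1; set i := M%:R^-1; have i0 : 0 <= i by rewrite invr_ge0 ltW.
  have : 0 <= k%:R * i * i by rewrite !mulr_ge0.
  lra.
apply: le_trans (bern _); rewrite -natr1 mulrDl mulfV ?gt_eqF // mul1r.
have : 0 <= M%:R^-1 :> R by rewrite invr_ge0 ltW.
lra.
Qed.

Section Forger.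
Variables (R : realType) (n : nat) (Sch : signature_scheme R n).
Variables (q m L : nat) (p : 'I_m -> R).
Hypothesis q_gt0 : (0 < q)%N.
Hypothesis p_ge0 : forall c, 0 <= p c.
Hypothesis complete : forall (c : 'I_m) O a, 0 < p c ->
  run O (ver Sch (vkey Sch O c) a (sig Sch O c a)) = true.
Hypothesis few_queries : forall (c : 'I_m) O a, 0 < p c ->
  (size (secretq Sch O c a) + size (verq Sch O c a) <= q)%N.
Hypothesis short_queries : forall (c : 'I_m) O a,
  all (short L) (secretq Sch O c a ++ verq Sch O c a).

Local Notation world := ('I_m * table L)%type.

Definition wins_against (A : bits -> bits -> oalg (n.-tuple bool * bits))
    (a : n.-tuple bool) (w : world) : bool :=
  wins Sch a (vkey Sch (extend w.2) w.1)
    (A (vkey Sch (extend w.2) w.1) (sig Sch (extend w.2) w.1 a)) w.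

(** [learn] is applied once for each view, starting from no known query. The input of the adversary
    tells it which tree to run, and the bounds add up over the views. *)
Lemma forger_of_pair a b k : b != a ->
  exists A : bits -> bits -> oalg (n.-tuple bool * bits),
    (forall O vk s, nqueries O (A vk s) <= k + q)%N /\
    2^-1 * (\sum_(w : world) p w.1 * (forgeable Sch a b w)%:R) -
      (1 - (4 * q%:R ^+ 2)^-1) ^+ k * (2 * q%:R * \sum_(w : world) p w.1) <=
    \sum_(w : world) p w.1 * (wins_against A a w)%:R.
Proof.
move=> ba.
pose W v : {set world} := [set w : world | (0 < p w.1) && (world_view Sch a w == v)]%SET.
have knowW v : knowledge Sch p a v [::] (W v).
  split=> [w|w|w w'|w F'].
  - by rewrite inE => /andP[].
  - by rewrite inE => /andP[_ /eqP].
  - by move=> _ _ x; rewrite in_nil.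
  - by rewrite !inE => /andP[/= -> _] -> _; rewrite eqxx.
have /choice[A hA] := fun v =>
  learn q_gt0 p_ge0 complete few_queries short_queries ba k (knowW v).
exists (fun vk s => A (vk, s)); split=> [Or vk s|]; first by case: (hA (vk, s)).
have pos (f : world -> R) : \sum_w p w.1 * f w = \sum_(w | 0 < p w.1) p w.1 * f w.
  rewrite [RHS]big_mkcond; apply: eq_bigr => w _; case: ifPn => // pw.
  by have -> : p w.1 = 0 by [apply/eqP; rewrite eq_le p_ge0 leNgt pw]; rewrite mul0r.
set rho := 1 - _.
pose count_new (w : world) := (q + count (fun x => x \notin [::]) (allq Sch a w))%N.
have pot_le : \sum_(w | 0 < p w.1) p w.1 * (count_new w)%:R <=
              2 * q%:R * \sum_(w : world) p w.1.
  rewrite -(mulr1 (\sum_w _)) mulr_suml pos mulr_sumr; apply: ler_sum => w pw.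
  rewrite mulr1 mulrC ler_wpM2r // -natrM ler_nat mul2n -addnn leq_add2l.
  exact: leq_trans (count_size _ _) (size_allq few_queries a pw).
have rho0 : 0 <= rho.
  have q1 : 1 <= q%:R :> R by rewrite ler1n.
  rewrite subr_ge0 invf_le1; last by rewrite mulr_gt0 // exprn_gt0 // (lt_le_trans ltr01).
  by rewrite -[leLHS]mul1r ler_pM ?ler1n // exprn_ege1.
have := @sum_fibers_ge0 R world _ (fun w => 0 < p w.1) (world_view Sch a)
  (fun v w => p w.1 * (wins Sch a v.1 (A v) w)%:R -
     (2^-1 * (p w.1 * (forgeable Sch a b w)%:R) -
      rho ^+ k * (p w.1 * (count_new w)%:R))).
have fiber v : 0 <= \sum_(w : world | (0 < p w.1) && (world_view Sch a w == v))
    (p w.1 * (wins Sch a v.1 (A v) w)%:R -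
     (2^-1 * (p w.1 * (forgeable Sch a b w)%:R) -
      rho ^+ k * (p w.1 * (count_new w)%:R))).
  rewrite (eq_bigl (mem (W v))); last by move=> w /=; rewrite inE.
  rewrite sumrB subr_ge0; apply: le_trans (proj2 (hA v)).
  by rewrite sumrB -!mulr_sumr.
move=> /(_ fiber); rewrite sumrB subr_ge0 sumrB -!mulr_sumr -!pos => main.
apply: le_trans main; rewrite lerD2l lerN2 ler_wpM2l ?exprn_ge0 //.
by rewrite pos.
Qed.

Hypothesis le_qn : (q <= n)%N.
Hypothesis mass_gt0 : 0 < \sum_(w : world) p w.1.

Lemma exists_forger :
  exists (a : n.-tuple bool) (A : bits -> bits -> oalg (n.-tuple bool * bits)),
    (forall O vk s, nqueries O (A vk s) <= 4 * q ^ 2 * (2 * q + 4) + q)%N /\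
    2^-1 ^+ (q + 3) * (\sum_(w : world) p w.1) <=
    \sum_(w : world) p w.1 * (wins_against A a w)%:R.
Proof.
move: mass_gt0; set mass := \sum_(w : world) p w.1 => mass0'.
have mass0 := ltW mass0'.
have [M cardM] : exists M : {set n.-tuple bool}, #|M| = (2 ^ q)%N.
  by apply: exists_card_set; rewrite card_tuple card_bool leq_exp2l.
pose pair_ok (z : n.-tuple bool * n.-tuple bool) :=
  [&& z.1 \in M, z.2 \in M & z.1 != z.2].
have many (w : world) : 0 < p w.1 ->
    2 ^+ q.-1 <= \sum_(z | pair_ok z) (forgeable Sch z.1 z.2 w)%:R :> R.
  move=> pw.
  have := @many_compatible_pairs _ _ q
    (fun a => secretq Sch (extend w.2) w.1 a)
    (fun a => verq Sch (extend w.2) w.1 a) M q_gt0.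
  move=> /(_ (fun a => few_queries (extend w.2) a pw)); rewrite cardM leqnn => /(_ isT).
  rewrite -(ler_nat R) natrX => /le_trans; apply.
  rewrite -sum1_card natr_sum big_mkcond [leRHS]big_mkcond; apply: ler_sum => z _.
  rewrite inE /pair_ok /forgeable /secrets.
  by case: (_ \in M); case: (_ \in M); case: (z.1 != z.2); case: (all _ _).
(* In each world at least [2 ^ q.-1] of at most [2 ^ (2q)] pairs are forgeable, so some pair reaches
   the average [2 ^ -(q+1)]. *)
have [/existsP[[a b] /andP[/and3P[/= _ _ ab] hab]]|] := boolP [exists z, pair_ok z &&
    (2^-1 ^+ q.+1 * mass <= \sum_(w : world) p w.1 * (forgeable Sch z.1 z.2 w)%:R)].
  have ba : b != a by rewrite eq_sym.
  (* Every [4 q ^ 2] steps halve the loss, so it ends below [2 ^ -(2q+4) * 2q <= 2 ^ -(q+3)] times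
     the mass; the gain is [2 ^ -(q+2)]. *)
  have [A [Aq hA]] := forger_of_pair (4 * q ^ 2 * (2 * q + 4)) ba.
  exists a, A; split=> //; apply: le_trans hA.
  have rho_le : (1 - (4 * q%:R ^+ 2)^-1) ^+ (4 * q ^ 2 * (2 * q + 4)) <=
      2^-1 ^+ (2 * q + 4) :> R.
    have -> : 4 * q%:R ^+ 2 = (4 * q ^ 2)%:R :> R by rewrite natrM natrX.
    have q2 : (0 < q ^ 2)%N by rewrite expn_gt0 q_gt0.
    rewrite exprM lerXn2r ?nnegrE ?exprn_ge0 ?invr_ge0 //.
      by rewrite subr_ge0 invf_le1 ?ler1n ?ltr0n muln_gt0.
    by apply: expr_1subV_le; lia.
  have q_le : q%:R * 2^-1 ^+ q <= 1 :> R.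
    by rewrite exprVn ler_pdivrMr ?exprn_gt0 // mul1r -natrX ler_nat ltnW // ltn_expl.
  have e1 : 2^-1 ^+ (2 * q + 4) * (2 * q%:R * mass) <= 2^-1 ^+ (q + 3) * mass.
    rewrite mulrA ler_wpM2r // mul2n -addnn !exprD; move: q_le.
    have : 0 < 2^-1 ^+ q :> R by rewrite exprn_gt0 // invr_gt0.
    set h := _ ^+ q => h0 q_le.
    rewrite (_ : _ * (2 * _) = h * 2^-1 ^+ 3 * (q%:R * h)); last by field.
    by rewrite ger_pMr // mulr_gt0 // exprn_gt0 // invr_gt0.
  have e2 : 2^-1 ^+ q.+1 * mass = 4 * (2^-1 ^+ (q + 3) * mass).
    by rewrite exprS exprD; field.
  have e3 : (1 - (4 * q%:R ^+ 2)^-1) ^+ (4 * q ^ 2 * (2 * q + 4)) * (2 * q%:R * mass)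
      <= 2^-1 ^+ (2 * q + 4) * (2 * q%:R * mass).
    by rewrite ler_wpM2r // !mulr_ge0.
  move: hab e1 e2 e3; rewrite -/mass.
  set X := _ ^+ (4 * _ * _) * _; set Y := _ ^+ (2 * q + 4) * _.
  set Z := _ ^+ (q + 3) * _; set S := \sum_w _; lra.
rewrite negb_exists => /forallP no; exfalso.
have total : 2 ^+ q.-1 * mass <=
    \sum_(z | pair_ok z) \sum_(w : world) p w.1 * (forgeable Sch z.1 z.2 w)%:R.
  rewrite exchange_big mulr_sumr; apply: ler_sum => w _; rewrite -mulr_sumr mulrC.
  have := p_ge0 w.1; rewrite le_eqVlt => /orP[/eqP <-|pw]; first by rewrite !mul0r.
  by rewrite ler_pM2l // many.
have [z0 ok0] : exists z, pair_ok z.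
  apply/existsP; apply: contraTT total; rewrite negb_exists => /forallP ok0.
  rewrite big_pred0; first by rewrite -ltNge mulr_gt0 // exprn_gt0.
  by move=> z; have /negPf := ok0 z.
have card_ok : (#|pair_ok| <= 2 ^ q * 2 ^ q)%N.
  rewrite -cardM -cardsX; apply/subset_leq_card/fintype.subsetP => z.
  by rewrite !inE => /and3P[-> -> _].
have : \sum_(z | pair_ok z) \sum_(w : world) p w.1 * (forgeable Sch z.1 z.2 w)%:R <
       \sum_(z | pair_ok z) 2^-1 ^+ q.+1 * mass.
  apply: ltr_sum => [|z okz]; first by apply/hasP; exists z0; rewrite ?mem_index_enum.
  by have := no z; rewrite okz /= -ltNge.
rewrite sumr_const => lt; have := le_lt_trans total lt; apply/negP; rewrite -leNgt.
rewrite -mulrnAl ler_wpM2r // -mulr_natl.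
apply: (@le_trans _ _ ((2 ^ q * 2 ^ q)%:R * 2^-1 ^+ q.+1)).
  by rewrite ler_wpM2r ?exprn_ge0 ?invr_ge0 // ler_nat.
rewrite natrM natrX le_eqVlt; apply/orP; left; apply/eqP.
rewrite -{1 2 3}(prednK q_gt0) !exprS exprVn; field.
by rewrite expf_neq0.
Qed.

End Forger.

(** * From tables to the random oracle *)

Local Open Scope classical_set_scope.

(** Integrals of nonnegative functions are suprema over the simple functions below them. The
    integrands of [forging_prob] are not shown to be measurable. *)
Lemma ge0_le_integralT (d : measure_display) (T : measurableType d)
    (R : realType) (mu : {measure set T -> \bar R}) (f g : T -> \bar R) :
  (forall x, 0 <= f x)%E -> (forall x, f x <= g x)%E ->
  (\int[mu]_x f x <= \int[mu]_x g x)%E.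
Proof.
move=> f0 fg; rewrite !ge0_integralTE //; last first.
  by move=> x; exact: le_trans (f0 x) (fg x).
apply: ereal_sup_le => _ [h /= hf <-]; exists h => //= x.
exact: le_trans (hf x) (fg x).
Qed.

Lemma integral_ge_sum_indic (d : measure_display) (T : measurableType d)
    (R : realType) (mu : {measure set T -> \bar R}) (J : finType)
    (E : J -> set T) (r : J -> R) (g : T -> \bar R) :
  (forall j, measurable (E j)) -> (forall j, 0 <= r j) ->
  (forall x, (\sum_j r j * \1_(E j) x)%:E <= g x)%E ->
  (\sum_j (r j)%:E * mu (E j) <= \int[mu]_x g x)%E.
Proof.
move=> mE r0 rg.
have ind0 j x : (0 <= (r j)%:E * (\1_(E j) x)%:E)%E.
  by rewrite -EFinM lee_fin mulr_ge0.
have mind j : measurable_fun [set: T] ((fun x => (\1_(E j) x)%:E) : T -> \bar R).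
  by apply/measurable_EFinP; exact: measurable_indic.
apply: (@le_trans _ _ (\int[mu]_x (\sum_j (r j)%:E * (\1_(E j) x)%:E))%E).
  rewrite ge0_integral_sum //; last first.
    by move=> j; apply: measurable_funeM; exact: mind.
  apply: lee_sum => j _.
  by rewrite ge0_integralZl ?lee_fin // integral_indic // setIT.
apply: ge0_le_integralT => x; first by rewrite sume_ge0.
by under eq_bigr do rewrite -EFinM; rewrite sumEFin.
Qed.

(** The partial sums tend to 1. Restricting to finitely many coins costs a factor 2. *)
Lemma exists_half_mass (R : realType) (mu : probability nat R) :
  exists m, 2^-1 <= \sum_(c < m) fine (mu [set (c : nat)]) :> R.
Proof.
apply: contrapT => /forallNP no.
have : (mu setT <= (2^-1)%:E)%E.
  have -> : setT = \bigcup_c [set c] :> set nat.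
    by apply/seteqP; split=> // c _; exists c.
  rewrite measure_semi_bigcup //; last first.
    by apply/trivIsetP => i j _ _ ij; apply/seteqP; split=> // x [/= -> /eqP]; rewrite (negPf ij).
  apply: lime_le; first by apply: is_cvg_nneseries.
  apply: nearW => m; rewrite big_mkord.
  have -> : (\sum_(c < m) mu [set (c : nat)] =
             (\sum_(c < m) fine (mu [set (c : nat)]))%:E)%E.
    by rewrite -sumEFin; apply: eq_bigr => c _; rewrite fineK // fin_num_measure.
  by rewrite lee_fin ltW // ltNge; apply/negP; exact: no.
by rewrite probability_setT lee_fin leNgt invf_lt1 ?ltr1n.
Qed.

(** The event is a finite intersection over the lengths below [L], to which independence applies. *)
Lemma random_oracle_table (R : realType) (d : measure_display)
    (T : measurableType d) (P : probability T R) (O : T -> oracle) (L : nat)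
    (F : table L) :
  is_random_oracle P O ->
  measurable [set w | restrict L (O w) = F] /\
  P [set w | restrict L (O w) = F] = (#|{: table L}|%:R^-1)%:E.
Proof.
move=> [mO uO iO].
have eqF : [set w | restrict L (O w) = F] =
    [set w | forall l, l \in iota 0 L -> O w l \in [set extend F l]%SET].
  apply/seteqP; split=> w /=.
    move=> <- l; rewrite mem_iota add0n /= => lL; rewrite inE; apply/eqP/ffunP => x.
    by have := extend_restrict (O w) (x := mkquery x) lL.
  move=> h; apply: eq_table => -[l x]; have [lL|lL] := ltnP l L.
    rewrite extend_restrict //; have := h l; rewrite mem_iota add0n lL /=.
    by move=> /(_ isT); rewrite inE /answer /= => /eqP ->.
  by rewrite /answer /extend /=; case: ltnP => // lL'; move: lL; rewrite leqNgt lL'.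
have mF : measurable [set w | restrict L (O w) = F].
  rewrite eqF (_ : [set w | _] = \bigcap_(l in [set` iota 0 L]) [set w | O w l = extend F l]).
    by apply: fin_bigcap_measurable => // l _; exact: mO.
  by apply/seteqP; split=> w h l /h; rewrite /= inE => /eqP.
split=> //; rewrite -[LHS]fineK ?fin_num_measure //; congr EFin.
rewrite eqF iO ?iota_uniq //.
have -> : #|{: table L}| = (\prod_(l < L) #|{: length_preserving l}|)%N.
  by rewrite card_dep_ffun foldrE big_map big_enum.
rewrite natr_prod -prodfV (eq_bigr (fun l => #|{: length_preserving l}|%:R^-1)).
  have -> : iota 0 L = index_iota 0 L by rewrite /index_iota subn0.
  by rewrite big_mkord.
move=> l _; rewrite (_ : [set w | _] = [set w | O w l = extend F l]) ?uO //.
by apply/seteqP; split=> w /=; rewrite inE => /eqP.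
Qed.

Lemma wins_forging_prob (R : realType) (n m L : nat) (Sch : signature_scheme R n)
    (A : bits -> bits -> oalg (n.-tuple bool * bits)) (a : n.-tuple bool)
    (O : oracle) (c : 'I_m) :
  all (short L) (secretq Sch (extend (restrict L O)) c a) ->
  wins_against Sch A a (c, restrict L O) ->
  forging_prob_given Sch
    (fun vk s => ProbOalg (@dirac _ nat 0 R : probability nat R) (fun=> A vk s))
    a O c = 1%E.
Proof.
move=> shq /andP[]; set O' := extend _ => /= runO' shO'.
have ag := agree_restrict O shq; have agl := agree_catl ag.
move: runO' shO'; rewrite -(agree_vkey agl) -(agree_sig agl (agree_catr ag)) => runO' shO'.
have := agree_run (agree_restrict O shO'); rewrite -/O' runO'.
rewrite /forging_prob_given /sig /vkey /skey; case: (run O (exec (gen Sch) c)) => sk vk /=.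
rewrite !run_obind /= => win; rewrite diracE mem_set //.
Qed.

Lemma exists_forging_adversary (R : realType) (q n : nat) (d : measure_display)
    (T : measurableType d) (P : probability T R) (O : T -> oracle)
    (Sch : signature_scheme R n) :
  (0 < q)%N -> (q <= n)%N -> is_random_oracle P O -> makes_at_most Sch q ->
  exists (a : n.-tuple bool) (A : adversary R n),
    adversary_at_most A (4 * q ^ 2 * (2 * q + 4) + q) /\
    ((2^-1 ^+ (q + 4))%:E <= forging_prob P O Sch A a)%E.
Proof.
move=> q0 qn roO atm.
have [m half] := exists_half_mass (coins (gen Sch)).
have [L shortL] := scheme_short Sch m.
pose p (c : 'I_m) : R := fine (coins (gen Sch) [set (c : nat)]).
have pE c : (p c)%:E = coins (gen Sch) [set (c : nat)].
  by rewrite fineK // fin_num_measure.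
have p0 c : 0 <= p c by rewrite -lee_fin pE measure_ge0.
have ppos c : 0 < p c -> (0 < coins (gen Sch) [set (c : nat)])%E.
  by rewrite -lte_fin pE.
have complete (c : 'I_m) O' a : 0 < p c ->
    run O' (ver Sch (vkey Sch O' c) a (sig Sch O' c a)) = true.
  move=> /ppos pc; apply: perfect_completeness.
  apply: lt_le_trans pc _; apply: le_measure; rewrite ?inE // => _ -> /=.
  by rewrite /vkey /skey -surjective_pairing.
have few (c : 'I_m) O' a : 0 < p c ->
    (size (secretq Sch O' c a) + size (verq Sch O' c a) <= q)%N.
  by move=> /ppos pc; rewrite -total_queriesE; exact: atm.
have sh (c : 'I_m) O' a : all (short L) (secretq Sch O' c a ++ verq Sch O' c a).
  by apply: shortL; exact: ltn_ord.
have tab0 : 0 < #|{: table L}|%:R :> R.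
  by rewrite ltr0n; apply/card_gt0P; exists (restrict L (fun=> [ffun x => x])).
have massE : \sum_(w : 'I_m * table L) p w.1 = (\sum_c p c) * #|{: table L}|%:R.
  rewrite -(pair_bigA _ (fun c _ => p c)) /= mulr_suml; apply: eq_bigr => c _.
  by rewrite sumr_const mulr_natr.
have mass_ge : #|{: table L}|%:R * 2^-1 <= \sum_(w : 'I_m * table L) p w.1.
  by rewrite massE mulrC ler_wpM2r // ltW.
have mass0 : 0 < \sum_(w : 'I_m * table L) p w.1.
  by apply: lt_le_trans mass_ge; rewrite mulr_gt0 // invr_gt0.
have [a [A [Aq hA]]] := exists_forger q0 p0 complete few sh qn mass0.
exists a, (fun vk s => ProbOalg (@dirac _ nat 0 R : probability nat R) (fun=> A vk s)).
split=> [Or vk s r|]; first exact: Aq.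
(* The oracles are split by their tables, of probability [1 / #|table L|] each. The coins below [m]
   have mass at least one half, which turns [q + 3] into [q + 4]. *)
pose E (j : 'I_m * table L) := [set w | restrict L (O w) = j.2].
apply: le_trans (integral_ge_sum_indic (E := E)
  (r := fun j => p j.1 * (wins_against Sch A a j)%:R) P _ _ _).
- rewrite (eq_bigr (fun j => (p j.1 * (wins_against Sch A a j)%:R *
      #|{: table L}|%:R^-1)%:E)); last first.
    move=> j _; rewrite [RHS]EFinM; congr (_ * _)%E.
    exact: (random_oracle_table j.2 roO).2.
  rewrite sumEFin lee_fin -mulr_suml ler_pdivlMr //.
  apply: le_trans hA; rewrite addnS exprSr -mulrA.
  by rewrite ler_wpM2l ?exprn_ge0 ?invr_ge0 // mulrC.
- by move=> j; exact: (random_oracle_table j.2 roO).1.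
- by move=> j; rewrite mulr_ge0.
move=> w; pose F := restrict L (O w).
apply: le_trans (integral_ge_sum_indic (E := fun c : 'I_m => [set (c : nat)])
  (r := fun c => (wins_against Sch A a (c, F))%:R) _ _ _ _).
- rewrite -(pair_bigA _ (fun c G => p c * (wins_against Sch A a (c, G))%:R * \1_(E (c, G)) w)) /=.
  rewrite -sumEFin; apply: lee_sum => c _; rewrite (bigD1 F) //= big1.
    rewrite addr0 /E indicE mem_set //= mulr1 mulrC EFinM pE.
    by [].
  by move=> G GF; rewrite indicE memNset ?mulr0 // => FG; move/eqP: GF; apply; exact: esym FG.
- by [].
- by [].
move=> c; have [cm|cm] := ltnP c m; last first.
  rewrite big1 ?measure_ge0 //.
    by rewrite /forging_prob_given; case: (run _ _) => sk vk; exact: measure_ge0.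
  by move=> i _; rewrite indicE memNset ?mulr0 //= => ci; move: cm; rewrite ci leqNgt ltn_ord.
rewrite (bigD1 (Ordinal cm)) //= big1; last first.
  move=> i ic; rewrite indicE memNset ?mulr0 //= => ci; move: ic.
  by rewrite -val_eqE /= ci eqxx.
rewrite addr0 indicE mem_set //= mulr1.
case win: (wins_against _ _ _ _); last first.
  by rewrite /forging_prob_given; case: (run _ _) => sk vk; exact: measure_ge0.
rewrite (@wins_forging_prob R n m L Sch A a (O w) (Ordinal cm)) //.
by have := sh (Ordinal cm) (extend F) a; rewrite all_cat => /andP[].
Qed.

(** * The size of the bound *)

Lemma ler_2powR2 (R : realType) (x : R) : 0 <= x -> x <= 2 `^ (2 * x).
Proof.
move=> x0; have ln2 : 2^-1 <= ln 2 :> R.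
  have := @le_ln1Dx R (- 2^-1); have -> : 1 + - 2^-1 = 2^-1 :> R by field.
  by rewrite lnV ?posrE // lerN2; apply; rewrite ltrN2 invf_lt1 // ltr1n.
rewrite /powR pnatr_eq0 /=; apply: le_trans (expR_ge1Dx _).
rewrite mulrC mulrA; have := ler_wpM2r x0 ln2; lra.
Qed.

Lemma poly_le_powR (R : realType) (q : nat) : (0 < q)%N ->
  (4 * q ^ 2 * (2 * q + 4) + q)%:R * 2 ^+ (q + 4) <=
  2 `^ ((1 + 42 * Num.sqrt (q.+1%:R^-1)) * q%:R) :> R.
Proof.
move=> q0; set x : R := Num.sqrt q.+1%:R.
have x1 : 1 <= x by rewrite -sqrtr1 ler_wsqrtr // ler1n.
have x0 : 0 <= x by exact: le_trans ler01 x1.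
have xx : x ^+ 2 = q%:R + 1 by rewrite sqr_sqrtr // natr1.
have q1 : 1 <= q%:R :> R by rewrite ler1n.
(* With [x ^ 2 = q + 1], the polynomial is at most [2 ^ 5 * x ^ 6], and [x ^ 6 <= 2 ^ (12 x)];
   together with [2 ^ 9 <= 2 ^ (9 x)] this uses [21 x]. Since [2q >= x ^ 2], [42 q / x] suffices. *)
have exp_ge : q%:R + 21 * x <= (1 + 42 * Num.sqrt (q.+1%:R^-1)) * q%:R.
  rewrite sqrtrV // -/x [leRHS]mulrDl [1 * _]mul1r lerD2l.
  have -> : 42 * x^-1 * q%:R = 21 * x + 21 * x^-1 * (2 * q%:R - x ^+ 2).
    by field; rewrite gt_eqF // (lt_le_trans ltr01).
  rewrite lerDl mulr_ge0 ?mulr_ge0 ?invr_ge0 // xx; lra.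
apply: (@le_trans _ _ (2 `^ (q%:R + 21 * x))); last first.
  by rewrite ler_powR // ler1n.
have poly : (4 * q ^ 2 * (2 * q + 4) + q)%:R <= 2 ^+ 5 * (x ^+ 2) ^+ 3 :> R.
  rewrite xx natr1 -!natrX -natrM ler_nat.
  rewrite (_ : 2 ^ 5 = 32)%N //; nia.
have x6 : (x ^+ 2) ^+ 3 <= 2 `^ (12 * x).
  rewrite -exprM (_ : 12 * x = 2 * x * 6%:R); last by ring.
  rewrite powRrM powR_mulrn ?powR_ge0 // lerXn2r ?nnegrE ?powR_ge0 //.
  exact: ler_2powR2.
have p9 : 2 ^+ 9 <= 2 `^ (9 * x) :> R.
  by rewrite -powR_mulrn // ler_powR ?ler1n // ler_peMr.
have -> : q%:R + 21 * x = q%:R + (9 * x + 12 * x) :> R by ring.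
rewrite powRD ?pnatr_eq0 ?implybT // powRD ?pnatr_eq0 ?implybT // powR_mulrn //.
rewrite exprD mulrCA ler_wpM2l ?exprn_ge0 //.
apply: le_trans (ler_wpM2r _ poly) _; first by rewrite exprn_ge0.
rewrite mulrAC -exprD; apply: ler_pM => //; exact: exprn_ge0 (exprn_ge0 _ _).
Qed.

Theorem theorem1p1 (R : realType) :
  exists eps : nat -> R,
    (eps @ \oo --> (0 : R)) /\
    forall (q n : nat) (d : measure_display) (T : measurableType d)
      (P : probability T R) (O : T -> oracle) (Sch : signature_scheme R n),
      (1 <= q)%N -> (q <= n)%N ->
      is_random_oracle P O ->
      makes_at_most Sch q ->
      blackbox_security_at_most P O Sch (2 `^ ((1 + eps q) * q%:R)).
Proof.
exists (fun q => 42 * Num.sqrt (q.+1%:R^-1)); split.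
  rewrite -(mulr0 42) -(sqrtr0 R); apply: cvgM; first exact: cvg_cst.
  exact: (continuous_cvg _ (@sqrt_continuous R 0) cvg_harmonic).
move=> q n d T P O Sch q0 qn roO atm S ltS sec.
have [a [A [At hA]]] := exists_forging_adversary q0 qn roO atm.
have := poly_le_powR R q0; set t := (4 * _ * _ + _)%N in At *; move=> tS.
(* For such an [S], the permitted success [t / S] is below the [2 ^ -(q+4)] that the forger
   reaches. *)
have {ltS}tS : t%:R * 2 ^+ (q + 4) < S by exact: le_lt_trans tS ltS.
have t0 : (1 <= t)%N by rewrite addn_gt0 q0 orbT.
have pow0 : 0 < 2 ^+ (q + 4) :> R by rewrite exprn_gt0.
have S0 : 0 < S by apply: lt_trans tS; rewrite mulr_gt0 // ltr0n.
have tleS : t%:R <= S.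
  by apply: le_trans (ltW tS); rewrite ler_peMr // exprn_ege1 // ler1n.
have := le_trans hA (sec a t A t0 tleS At).
rewrite lee_fin leNgt => /negP; apply.
by rewrite exprVn ltr_pdivrMr // ltr_pdivlMl // mulrC.
Qed.
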